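(* For every integer $n\geq 3$, the dominating graph $\mathcal{D}(C_n)$ of the cycle $C_n$ on $n$ vertices has a Hamilton path if and only if $n\not\equiv 0 \pmod 4$.
   Context: All graphs are finite and simple. For a graph $H$, a dominating set of $H$ is a set $D\subseteq V(H)$ such that every vertex of $V(H)\setminus D$ is adjacent to a vertex of $D$. The dominating graph $\mathcal{D}(H)$ is the graph whose vertices are all dominating sets of $H$, in which two distinct dominating sets $X,Y$ are adjacent if and only if $Y$ is obtained from $X$ by adding a single vertex of $H$ or deleting a single vertex of $X$ (i.e. $|X\triangle Y|=1$). *)

(* Defs.v *)
From mathcomp Require Import all_boot.

Set Implicit Arguments.
Unset Strict Implicit.
Unset Printing Implicit Defensive.

Record sgraph := SGraph {
  svertex :> finType;
  sedge : rel svertex;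
  sedge_sym : symmetric sedge;
  sedge_irr : irreflexive sedge }.

Definition dominating (H : sgraph) (D : {set H}) : bool :=
  [forall v in ~: D, [exists u in D, sedge v u]].

Section DominatingGraph.
Variable H : sgraph.

Definition domset := {D : {set H} | dominating D}.

Definition dom_edge : rel domset :=
  fun X Y => #|(val X :\: val Y) :|: (val Y :\: val X)| == 1.

Lemma dom_edge_sym : symmetric dom_edge.
Proof. by move=> X Y; rewrite /dom_edge setUC. Qed.

Lemma dom_edge_irr : irreflexive dom_edge.
Proof. by move=> X; rewrite /dom_edge setDv setU0 cards0. Qed.

Definition dominating_graph : sgraph := SGraph dom_edge_sym dom_edge_irr.

End DominatingGraph.

Section CycleGraph.
Variable n : nat.

(* [ordS i] is [i + 1] modulo [n].  The condition [i != j] only matters for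
   [n = 1], where it excludes the loop. *)
Definition cycle_edge : rel 'I_n :=
  fun i j => (i != j) && ((ordS i == j) || (ordS j == i)).

Lemma cycle_edge_sym : symmetric cycle_edge.
Proof. by move=> i j; rewrite /cycle_edge eq_sym orbC. Qed.

Lemma cycle_edge_irr : irreflexive cycle_edge.
Proof. by move=> i; rewrite /cycle_edge eqxx. Qed.

Definition cycle_graph : sgraph := SGraph cycle_edge_sym cycle_edge_irr.

End CycleGraph.

Definition has_hamilton_path (G : sgraph) : Prop :=
  exists (x : G) (p : seq G),
    [/\ path (@sedge G) x p, uniq (x :: p) & forall y : G, y \in x :: p].

(* Main.v *)
(* Encode a set D of vertices of C_n by the cyclic word that has a letter 1
   (true) at each vertex outside D.  Then D dominates iff the word has no cyclic
   factor 111, and adjacency in the dominating graph is Hamming distance 1.  Words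
   with an odd and with an even number of 1s alternate along a path; for
   n = 4k their numbers differ by 3, so there is no Hamilton path.
   Otherwise, let F_m be the set of linear words of length m without factor 111.
   It has a Gray code [fib m] that runs from 01100110... to 11001100..., by the
   recursion F_(m+3) = 0 F_(m+2) + 10 F_(m+1) + 110 F_m.  The cyclic words form
   the disjoint union of 0 F_(n-1), 10 F_(n-3) 0, 10 F_(n-4) 01 and
   110 F_(n-4) 0; splitting these blocks further by the same recursion, read from
   the left or from the right, gives blocks u F_m v whose Gray codes, suitably
   reversed or mirrored, can be concatenated.  The order of the blocks depends on
   n modulo 4 and was found by a computer search. *)
Require Import Defs.
From mathcomp Require Import all_boot.
From mathcomp Require Import zify.

Set Implicit Arguments.
Unset Strict Implicit.
Unset Printing Implicit Defensive.

(** * Binary words and Hamming adjacency *)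

Notation word := (seq bool).

Fixpoint adj (x y : word) : bool :=
  match x, y with
  | a :: x', b :: y' => if a == b then adj x' y' else x' == y'
  | _, _ => false
  end.

Arguments adj !x !y.

Lemma adjP x y :
  reflect (exists s a t, x = s ++ a :: t /\ y = s ++ ~~ a :: t) (adj x y).
Proof.
apply: (iffP idP) => [|[s [a [t [-> ->]]]]]; last first.
  by elim: s => [|b s IH] /=; rewrite ?eqxx //; case: a.
elim: x y => [|a x IH] [|b y] //=; case: eqP => [<- /IH|nab /eqP <-].
  by move=> [s [c [t [-> ->]]]]; exists (a :: s), c, t.
by exists [::], a, x; split=> //=; congr (_ :: _); case: a b nab => [] [].
Qed.

Lemma adj_sym : symmetric adj.
Proof.
suff H x y : adj x y -> adj y x by move=> x y; apply/idP/idP; apply: H.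
move=> /adjP[s [a [t [-> ->]]]]; apply/adjP.
by exists s, (~~ a), t; rewrite negbK.
Qed.

Lemma adj_catl u x y : adj (u ++ x) (u ++ y) = adj x y.
Proof. by elim: u => //= a u ->; rewrite eqxx. Qed.

Lemma adj_catr v x y : adj x y -> adj (x ++ v) (y ++ v).
Proof.
move=> /adjP[s [a [t [-> ->]]]]; apply/adjP.
by exists s, a, (t ++ v); rewrite -!catA.
Qed.

Lemma adj_rev x y : adj x y -> adj (rev x) (rev y).
Proof.
move=> /adjP[s [a [t [-> ->]]]]; apply/adjP.
by exists (rev t), a, (rev s); rewrite !rev_cat !rev_cons -!cats1 -?catA.
Qed.

Lemma adj_map (T : Type) (f g : T -> bool) s :
  adj (map f s) (map g s) = (count (fun i => f i != g i) s == 1).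
Proof.
elim: s => //= i s ->; case: eqP => //= _.
rewrite add1n eqSS -leqn0 leqNgt -has_count -all_predC.
by elim: s => //= j s <-; rewrite eqseq_cons negbK.
Qed.

Definition parity (w : word) := odd (count id w).

Lemma adj_parity x y : adj x y -> parity y = ~~ parity x.
Proof.
move=> /adjP[s [a [t [-> ->]]]].
by rewrite /parity !count_cat /= !oddD; case: a => /=; do 2!case: (odd _).
Qed.

Lemma sorted_adj_balance s : sorted adj s ->
  count parity s <= (count (predC parity) s).+1 /\
  count (predC parity) s <= (count parity s).+1.
Proof.
case: s => // x p; have -> : sorted adj (x :: p) = path adj x p by [].
(* The induction needs to know which class leads: since parities alternate, it is the class of the
   first word, by 0 or 1. *)
move=> Hp; suff: if parity x then
    count (predC parity) (x :: p) <= count parity (x :: p)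
      <= (count (predC parity) (x :: p)).+1
  else count parity (x :: p) <= count (predC parity) (x :: p)
      <= (count parity (x :: p)).+1.
  by move: (count parity _) (count _ _) => a b; case: ifP; lia.
elim: p x Hp => [|y p IH] x /=; first by case: (parity x).
move=> /andP[/adj_parity xy /IH] /=; rewrite xy.
by case: (parity x) => /=; lia.
Qed.

(** * Linear words without factor 111, and their enumeration *)

Fixpoint no111 (w : word) : bool :=
  if w is a :: w' then ~~ [&& a, nth false w' 0 & nth false w' 1] && no111 w'
  else true.

Lemma no111P w :
  reflect (forall i, ~~ [&& nth false w i, nth false w i.+1 & nth false w i.+2])
          (no111 w).
Proof.
apply: (iffP idP); elim: w => [|a w IH] //=.
- by move=> _ [|i].
- by case/andP=> H H'; case=> [|i]; [|exact: IH].
- move=> H; apply/andP; split; first exact: (H 0).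
  by apply: IH => i; apply: (H i.+1).
Qed.

Lemma no111_rev w : no111 (rev w) = no111 w.
Proof.
suff H v : no111 v -> no111 (rev v).
  by apply/idP/idP=> /H; rewrite ?revK.
move=> /no111P Hv; apply/no111P => i.
case: (ltnP i.+2 (size v)) => Hi; last first.
  by rewrite [X in [&& _, _ & X]]nth_default ?size_rev ?andbF.
rewrite !nth_rev; try lia; have := Hv (size v - i.+3).
have -> : (size v - i.+3).+1 = size v - i.+2 by lia.
have -> : (size v - i.+2).+1 = size v - i.+1 by lia.
by apply: contra => /and3P[-> -> ->].
Qed.

(** For words of length at least 3, repeating the first two letters at the end turns the cyclic
    factors of length 3 into linear ones. *)
Definition lucas (w : word) := no111 (w ++ take 2 w).

Fixpoint words m : seq word :=
  if m is m'.+1 then map (cons false) (words m') ++ map (cons true) (words m')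
  else [:: [::]].

Lemma mem_words m w : (w \in words m) = (size w == m).
Proof.
elim: m w => [|m IH] w; first by rewrite inE size_eq0.
rewrite mem_cat; case: w => [|a w] /=.
  by apply/negP => /orP[] /mapP[].
apply/orP/idP => [[] /mapP[v]|].
- by rewrite IH => /eqP<- [_ ->]; rewrite eqxx.
- by rewrite IH => /eqP<- [_ ->]; rewrite eqxx.
by rewrite eqSS -IH; case: a => Hw; [right|left]; apply: map_f.
Qed.

Lemma uniq_words m : uniq (words m).
Proof.
elim: m => //= m IH; have inj b : injective (@cons bool b) by move=> ? ? [].
rewrite cat_uniq !map_inj_uniq // IH /= andbT.
by apply/hasPn => w /mapP[v _ ->]; apply/mapP => -[].
Qed.

Lemma count_wordsS (P : pred word) m :
  count P (words m.+1) = count (fun w => P (false :: w)) (words m)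
                       + count (fun w => P (true :: w)) (words m).
Proof. by rewrite /= count_cat !count_map. Qed.

Lemma count_words_rev (P : pred word) m :
  count P (words m) = count (fun w => P (rev w)) (words m).
Proof.
rewrite -[RHS](count_map (fun w => rev w) P).
apply: (permP _); apply: uniq_perm.
- exact: uniq_words.
- by rewrite (map_inj_uniq (can_inj (@revK _))) uniq_words.
move=> w; rewrite -{2}(revK w) (mem_map (can_inj (@revK _))).
by rewrite !mem_words size_rev.
Qed.

(** The predicate stays arbitrary: counting identities valid for every [P] give [perm_eq], and
    [P := parity] gives the sizes of the parity classes. *)
Definition nfib (P : pred word) m := count (fun w => no111 w && P w) (words m).

Lemma eq_nfib P Q m : P =1 Q -> nfib P m = nfib Q m.
Proof. by move=> PQ; apply: eq_count => w; rewrite PQ. Qed.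

Lemma nfib_rev P m : nfib P m = nfib (fun w => P (rev w)) m.
Proof.
by rewrite /nfib count_words_rev; apply: eq_count => w; rewrite no111_rev.
Qed.

Lemma nfibS3 P m :
  nfib P m.+3 = nfib (fun w => P (false :: w)) m.+2
              + nfib (fun w => P [:: true, false & w]) m.+1
              + nfib (fun w => P [:: true, true, false & w]) m.
Proof.
rewrite {1}/nfib count_wordsS [X in _ + X]count_wordsS.
rewrite [X in _ + (_ + X)]count_wordsS.
rewrite [X in _ + (_ + (_ + X))](eq_count (a2 := pred0)) // count_pred0 addn0.
by rewrite addnA.
Qed.

Lemma nfibS3r P m :
  nfib P m.+3 = nfib (fun w => P (w ++ [:: false])) m.+2
              + nfib (fun w => P (w ++ [:: false; true])) m.+1
              + nfib (fun w => P (w ++ [:: false; true; true])) m.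
Proof.
rewrite nfib_rev nfibS3; congr (_ + _ + _);
  rewrite [RHS]nfib_rev; apply: eq_nfib => w;
  by rewrite !rev_cons -!cats1 -?catA.
Qed.

(** * Block decomposition of the cyclic words *)

Definition lucas_words n := [seq w <- words n | lucas w].

(** No factor 111 can cross a 0. *)
Lemma no111_cat0 u v : no111 (u ++ false :: v) = no111 u && no111 v.
Proof.
elim: u => //= a u ->; rewrite andbA; congr (~~ _ && _ && _).
by case: u => [|b [|c u]] //=; rewrite ?andbF.
Qed.

Lemma lucas0 w : lucas (false :: w) = no111 w.
Proof.
by rewrite /lucas /= no111_cat0; case: w => [|[] [|b w]]; rewrite /= ?andbT.
Qed.

(** By wrap-around, the leading 1 prolongs a run at the end of [w]. The right side is reversed so
    that [count_wordsS] can split off the last letters of [w]. *)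
Lemma lucas10 w : lucas [:: true, false & w] = no111 (true :: rev w).
Proof.
rewrite -[RHS]no111_rev /lucas rev_cons revK -cats1.
by have := no111_cat0 (w ++ [:: true]) [::]; rewrite -catA /= take0 andbT.
Qed.

Lemma lucas110 w :
  lucas [:: true, true, false & w] = no111 [:: true, true & rev w].
Proof. by rewrite -[RHS]no111_rev /lucas !rev_cons revK -!cats1 -catA. Qed.

Lemma count_lucas_words P m :
  count P (lucas_words m.+4) =
    nfib (fun w => P (false :: w)) m.+3
  + nfib (fun w => P [:: true, false & w ++ [:: false]]) m.+1
  + nfib (fun w => P [:: true, false & w ++ [:: false; true]]) m
  + nfib (fun w => P [:: true, true, false & w ++ [:: false]]) m.
Proof.
rewrite count_filter count_wordsS [X in _ + X]count_wordsS.
rewrite [X in _ + (_ + X)]count_wordsS.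
rewrite [X in _ + (_ + (_ + X))](eq_count (a2 := pred0)); last first.
  by move=> w /=; rewrite /lucas /= andbF.
rewrite count_pred0 addn0 -!addnA; congr (_ + _).
  by apply: eq_count => w; rewrite /= lucas0 andbC.
rewrite [RHS]addnA; congr (_ + _).
  (* After the prefix 10, the rest ends in 0 or 01: an ending 11 would meet the leading 1. *)
  rewrite count_words_rev count_wordsS [X in _ + X]count_wordsS.
  rewrite [X in _ + (_ + X)](eq_count (a2 := pred0)) ?count_pred0 ?addn0.
    rewrite [X in _ = X + _]nfib_rev [X in _ = _ + X]nfib_rev.
    congr (_ + _); apply: eq_count => w;
    by rewrite /= lucas10 revK andbC !rev_cons -!cats1 -?catA.
  by move=> w /=; rewrite lucas10 revK /= andbF.
(* After the prefix 110, the rest must end in 0. *)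
rewrite count_words_rev count_wordsS.
rewrite [X in _ + X](eq_count (a2 := pred0)) ?count_pred0 ?addn0.
  rewrite [RHS]nfib_rev; apply: eq_count => w;
  by rewrite /= lucas110 revK andbC !rev_cons -!cats1.
by move=> w /=; rewrite lucas110 revK /= andbF.
Qed.

(** * The Gray code of F_m, and walks built from it *)

Fixpoint fib m : seq word :=
  match m with
  | 0 => [:: [::]]
  | 1 => [:: [:: false]; [:: true]]
  | 2 => [:: [:: false; true]; [:: false; false]; [:: true; false];
             [:: true; true]]
  | ((m3.+1 as m2).+1 as m1).+1 =>
    map (cons false) (rev (fib m1)) ++
    map (cat [:: true; false]) (rev (fib m2)) ++
    map (cat [:: true; true; false]) (rev (fib m3))
  end.

Lemma nat_ind3 (P : nat -> Prop) :
  P 0 -> P 1 -> P 2 -> (forall m, P m -> P m.+1 -> P m.+2 -> P m.+3) ->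
  forall m, P m.
Proof.
move=> P0 P1 P2 PS m; suff: P m /\ P m.+1 /\ P m.+2 by case.
by elim: m => // m [? [? ?]]; do 2!split=> //; apply: PS.
Qed.

Lemma count_fib P m : count P (fib m) = nfib P m.
Proof.
elim/nat_ind3: m P => [||| m IH0 IH1 IH2] P.
- by rewrite /nfib /=.
- by rewrite /nfib /=.
- by rewrite /nfib /=; lia.
by rewrite [fib _]/= !count_cat !count_map !count_rev IH0 IH1 IH2 nfibS3 addnA.
Qed.

(** The endpoints are recorded because joining two lists only requires adjacency at the junction. *)
Definition walk (x y : word) (s : seq word) :=
  exists p, [/\ s = x :: p, path adj x p & last x p = y].

Lemma walk_sorted x y s : walk x y s -> sorted adj s.
Proof. by case=> p [->]. Qed.

Lemma walk_cat x y z t s s' :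
  walk x y s -> adj y z -> walk z t s' -> walk x t (s ++ s').
Proof.
move=> [p [-> Hp <-]] Hyz [q [-> Hq <-]]; exists (p ++ z :: q); split=> //.
  by rewrite cat_path Hp /= Hyz.
by rewrite last_cat.
Qed.

Lemma walk_rev x y s : walk x y s -> walk y x (rev s).
Proof.
move=> [p [-> Hp <-]]; exists (rev (belast x p)); split.
- by rewrite lastI rev_rcons.
- by rewrite rev_path (eq_path (e' := adj)) // => ? ?; rewrite adj_sym.
- by case: p Hp => //= a p _; rewrite rev_cons last_rcons.
Qed.

Lemma walk_map f x y s : {homo f : u v / adj u v} ->
  walk x y s -> walk (f x) (f y) (map f s).
Proof.
move=> Hf [p [-> Hp <-]]; exists (map f p).
split=> //; last by rewrite last_map.
by rewrite path_map; apply: sub_path Hp.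
Qed.

Definition sandwich (u v : word) s := [seq u ++ w ++ v | w <- s].

Lemma count_sandwich (P : pred word) u v s :
  count P (sandwich u v s) = count (fun w => P (u ++ w ++ v)) s.
Proof. by rewrite count_map. Qed.

Lemma count_sandwich0 (P : pred word) u s :
  count P (sandwich u [::] s) = count (fun w => P (u ++ w)) s.
Proof. by rewrite count_sandwich; apply: eq_count => w; rewrite cats0. Qed.

Lemma walk_sandwich u v x y s :
  walk x y s -> walk (u ++ x ++ v) (u ++ y ++ v) (sandwich u v s).
Proof.
apply: (walk_map (f := fun w => u ++ w ++ v)) => a b Hab.
by rewrite adj_catl adj_catr.
Qed.

Lemma walk_mirror x y s : walk x y s -> walk (rev x) (rev y) (map rev s).
Proof. by apply: walk_map => ? ?; apply: adj_rev. Qed.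

Fixpoint periodic (a b c d : bool) m : word :=
  if m is m'.+1 then a :: periodic b c d a m' else [::].

(** Over whole periods, a letter can move from one side of the block to the other if the pattern is
    rotated; this aligns the two words at a junction. *)
Lemma periodic_shift a b c d k s :
  periodic a b c d (4 * k) ++ a :: s = a :: periodic b c d a (4 * k) ++ s.
Proof. by elim: k => // k IH; rewrite mulnS /= IH. Qed.

Lemma rev_periodic a b c d k :
  rev (periodic a b c d (4 * k)) = periodic d c b a (4 * k).
Proof.
elim: k => // k IH; rewrite mulnS /= !rev_cons IH -!cats1 -!catA /=.
by rewrite !periodic_shift cats0.
Qed.

Lemma fib_walk m :
  walk (periodic false true true false m) (periodic true true false false m)
       (fib m).
Proof.
elim/nat_ind3: m => [||| m IH0 IH1 IH2].
- by exists [::].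
- by exists [:: [:: true]].
- by exists [:: [:: false; false]; [:: true; false]; [:: true; true]].
have W u m' : walk (periodic false true true false m')
    (periodic true true false false m') (fib m') ->
  walk (u ++ periodic true true false false m')
    (u ++ periodic false true true false m') (map (cat u) (rev (fib m'))).
  move=> /walk_rev; apply: walk_map => ? ?; by rewrite adj_catl.
(* At the junctions, 00110... meets 10110..., differing in the first letter, and 100110... meets
   110110..., differing in the second. *)
apply: (walk_cat (W [:: false] _ IH2)); last first.
  by apply: (walk_cat (W _ _ IH1) _ (W _ _ IH0)); rewrite /= eqxx.
by rewrite /= eqxx.
Qed.

(** F_m is closed under reversal, so the mirrored code covers the same block with other
    endpoints. *)
Lemma count_mirror P m : count P (map rev (fib m)) = nfib P m.
Proof. by rewrite count_map count_fib [RHS]nfib_rev; apply: eq_nfib. Qed.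

(* The periodic middle parts of the two words must be aligned: as far right as
   possible if the words differ on the left of them, else as far left as
   possible. *)
Ltac adj_periodic :=
  rewrite /= ?rev_cons ?rev_periodic -?cats1 -?catA /=;
  first [ by rewrite ?adj_catl
        | by rewrite !periodic_shift /= ?eqxx
        | by rewrite -!periodic_shift adj_catl ].

Ltac count_gray :=
  rewrite !count_cat !(count_sandwich0, count_sandwich)
          !(count_rev, count_mirror, count_fib) count_lucas_words.

(** * Gray codes of the cyclic words by residue modulo 4, and the parity obstruction *)

Definition gray_list (s t : seq word) := sorted adj s /\ perm_eq s t.

Lemma lucas_gray_mod1 k : exists s, gray_list s (lucas_words (4 * k).+1.+4).
Proof.
exists (
     sandwich [:: true; false] [:: false; true] (map rev (fib (4 * k).+1))
  ++ sandwich [:: true; false] [:: false] (map rev (fib (4 * k).+2))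
  ++ sandwich [:: false; false] [:: false] (rev (fib (4 * k).+2))
  ++ sandwich [:: false] [:: false; true; true] (map rev (fib (4 * k).+1))
  ++ sandwich [:: false] [:: false; true] (map rev (fib (4 * k).+2))
  ++ sandwich [:: false; true; true; false] [:: false] (fib (4 * k))
  ++ sandwich [:: false; true; false] [:: false] (fib (4 * k).+1)
  ++ sandwich [:: true; true; false] [:: false] (rev (fib (4 * k).+1))).
split; last first.
  apply/seq.permP => P; count_gray.
  (* The block 0 F_(4k+4) is split from the right, then its part 0 F_(4k+3) 0 from the left. *)
  rewrite nfibS3r (nfibS3 (fun w => P (false :: w ++ _))) /=; lia.
refine (walk_sorted
   (walk_cat (walk_sandwich _ _ (walk_mirror (fib_walk _))) _
   (walk_cat (walk_sandwich _ _ (walk_mirror (fib_walk _))) _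
   (walk_cat (walk_sandwich _ _ (walk_rev (fib_walk _))) _
   (walk_cat (walk_sandwich _ _ (walk_mirror (fib_walk _))) _
   (walk_cat (walk_sandwich _ _ (walk_mirror (fib_walk _))) _
   (walk_cat (walk_sandwich _ _ (fib_walk _)) _
   (walk_cat (walk_sandwich _ _ (fib_walk _)) _
    (walk_sandwich _ _ (walk_rev (fib_walk _))))))))))); adj_periodic.
Qed.

Lemma lucas_gray_mod2 k : exists s, gray_list s (lucas_words (4 * k).+2.+4).
Proof.
exists (
     sandwich [:: false; false] [:: false; true; true] (rev (fib (4 * k).+1))
  ++ sandwich [:: false; true; false] [:: false; true; true] (rev (fib (4 * k)))
  ++ sandwich [:: false; true; true; false] [::] (rev (fib (4 * k).+2))
  ++ sandwich [:: false; true; false] [:: false; true]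
       (map rev (fib (4 * k).+1))
  ++ sandwich [:: false; true; false] [:: false] (map rev (fib (4 * k).+2))
  ++ sandwich [:: false; false] [:: false] (fib (4 * k).+3)
  ++ sandwich [:: false; false] [:: false; true] (rev (fib (4 * k).+2))
  ++ sandwich [:: true; false] [:: false; true] (fib (4 * k).+2)
  ++ sandwich [:: true; false] [:: false] (rev (fib (4 * k).+3))
  ++ sandwich [:: true; true; false] [:: false] (rev (fib (4 * k).+2))).
split; last first.
  apply/seq.permP => P; count_gray.
  (* The block 0 F_(4k+5) is split from the left, then its parts 00 F_(4k+4) and 010 F_(4k+3) from
     the right. *)
  rewrite (nfibS3 (fun w => P (false :: w))).
  rewrite (nfibS3r (fun w => P [:: false, false & w])).
  rewrite (nfibS3r (fun w => P [:: false, true, false & w])) /=; lia.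
refine (walk_sorted
   (walk_cat (walk_sandwich _ _ (walk_rev (fib_walk _))) _
   (walk_cat (walk_sandwich _ _ (walk_rev (fib_walk _))) _
   (walk_cat (walk_sandwich _ _ (walk_rev (fib_walk _))) _
   (walk_cat (walk_sandwich _ _ (walk_mirror (fib_walk _))) _
   (walk_cat (walk_sandwich _ _ (walk_mirror (fib_walk _))) _
   (walk_cat (walk_sandwich _ _ (fib_walk _)) _
   (walk_cat (walk_sandwich _ _ (walk_rev (fib_walk _))) _
   (walk_cat (walk_sandwich _ _ (fib_walk _)) _
   (walk_cat (walk_sandwich _ _ (walk_rev (fib_walk _))) _
    (walk_sandwich _ _ (walk_rev (fib_walk _))))))))))))); adj_periodic.
Qed.

Lemma lucas_gray_mod3 k : exists s, gray_list s (lucas_words (4 * k).+3.+4).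
Proof.
exists (
     sandwich [:: false] [::] (rev (map rev (fib (4 * k).+3.+3)))
  ++ sandwich [:: true; true; false] [:: false] (fib (4 * k).+3)
  ++ sandwich [:: true; false] [:: false] (fib (4 * k).+4)
  ++ sandwich [:: true; false] [:: false; true] (rev (fib (4 * k).+3))).
split; last first.
  apply/seq.permP => P; count_gray.
  (* Here the four blocks of [count_lucas_words] are used unsplit. *)
  by rewrite /=; lia.
refine (walk_sorted
   (walk_cat (walk_sandwich _ _ (walk_rev (walk_mirror (fib_walk _)))) _
   (walk_cat (walk_sandwich _ _ (fib_walk _)) _
   (walk_cat (walk_sandwich _ _ (fib_walk _)) _
    (walk_sandwich _ _ (walk_rev (fib_walk _))))))); adj_periodic.
Qed.

(** Length 3 lies below the range of the four-block decomposition. [behead] drops the word 11, which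
    would yield 111; the junction is from 011 to 010. *)
Lemma lucas_gray3 : exists s, gray_list s (lucas_words 3).
Proof.
by exists (sandwich [::] [:: true] (behead (rev (fib 2)))
        ++ sandwich [::] [:: false] (fib 2)).
Qed.

(** The excess e_m of even over odd words satisfies e_(m+3) = e_(m+2) - e_(m+1) + e_m, because only
    the prefix 10 flips parity. The characteristic polynomial (x-1)(x^2+1) gives period 4, with
    values 1, 0, 0, 1. *)
Lemma nfib_parity k :
  [/\ nfib (predC parity) (4 * k) = (nfib parity (4 * k)).+1,
      nfib (predC parity) (4 * k).+1 = nfib parity (4 * k).+1,
      nfib (predC parity) (4 * k).+2 = nfib parity (4 * k).+2 &
      nfib (predC parity) (4 * k).+3 = (nfib parity (4 * k).+3).+1].
Proof.
have E m : nfib parity m.+3 =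
    nfib parity m.+2 + nfib (predC parity) m.+1 + nfib parity m.
  rewrite nfibS3; congr (_ + _ + _); apply: eq_nfib => w;
  by rewrite /parity /= ?negbK.
have O m : nfib (predC parity) m.+3 =
    nfib (predC parity) m.+2 + nfib parity m.+1 + nfib (predC parity) m.
  rewrite nfibS3; congr (_ + _ + _); apply: eq_nfib => w;
  by rewrite /parity /= ?negbK.
elim: k => [|k [IH0 IH1 IH2 IH3]].
  by split; vm_compute.
by rewrite mulnS !addSn add0n !(E, O); split; lia.
Qed.

(** Of the four blocks only 10 F_(4k+1) 0 flips parity, so the even words exceed the odd ones by
    e_(4k+3) - e_(4k+1) + 2 e_(4k) = 1 - 0 + 2 = 3, while an alternating list allows at most 1. *)
Lemma lucas_no_gray_mod0 k s : ~ gray_list s (lucas_words (4 * k).+4).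
Proof.
move=> [/sorted_adj_balance + /seq.permP Hs]; rewrite !{}Hs.
have E : count parity (lucas_words (4 * k).+4) = nfib parity (4 * k).+3
  + nfib (predC parity) (4 * k).+1 + nfib parity (4 * k) + nfib parity (4 * k).
  rewrite count_lucas_words; congr (_ + _ + _ + _); apply: eq_nfib => w;
  by rewrite /parity /= ?count_cat /= ?oddD /= ?negbK; case: (odd _).
have O : count (predC parity) (lucas_words (4 * k).+4) =
    nfib (predC parity) (4 * k).+3 + nfib parity (4 * k).+1
  + nfib (predC parity) (4 * k) + nfib (predC parity) (4 * k).
  rewrite count_lucas_words; congr (_ + _ + _ + _); apply: eq_nfib => w;
  by rewrite /parity /= ?count_cat /= ?oddD /= ?negbK; case: (odd _).
have [E0 E1 _ E3] := nfib_parity k.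
by rewrite E O E0 E1 E3; lia.
Qed.

(** * Dominating sets of the cycle as cyclic words *)

Definition missing n (D : {set 'I_n}) : word :=
  [seq i \notin D | i <- enum 'I_n].

Lemma size_missing n (D : {set 'I_n}) : size (missing D) = n.
Proof. by rewrite size_map size_enum_ord. Qed.

Lemma nth_missing n (D : {set 'I_n}) (i : 'I_n) :
  nth false (missing D) i = (i \notin D).
Proof. by rewrite (nth_map i) ?size_enum_ord // nth_ord_enum. Qed.

Lemma missing_inj n : injective (@missing n).
Proof.
move=> D E DE; apply/setP => i.
by apply: negb_inj; rewrite -!nth_missing DE.
Qed.

Lemma nth_missing_cyclic n (D : {set 'I_n}) p : 2 < n -> p < n.+2 ->
  nth false (missing D ++ take 2 (missing D)) p =
  nth false (missing D) (p %% n).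
Proof.
move=> n_gt2 lt_p; rewrite nth_cat size_missing.
case: ltnP => [/modn_small -> //|le_np].
rewrite nth_take; last by lia.
by rewrite -{2}(subnKC le_np) modnDl modn_small //; lia.
Qed.

Lemma lucas_missingP n (D : {set 'I_n}) : 2 < n ->
  reflect (forall i, ~~ [&& i \notin D, ordS i \notin D
                          & ordS (ordS i) \notin D])
          (lucas (missing D)).
Proof.
move=> n_gt2.
have E (i : 'I_n) : nth false (missing D ++ take 2 (missing D)) i.+2
    = (ordS (ordS i) \notin D).
  have lt_i := ltn_ord i; rewrite nth_missing_cyclic //.
  rewrite -nth_missing /=; congr (nth _ _ _).
  by rewrite -addn1 -[in RHS]addn1 modnDml addn1.
have F (i : 'I_n) : nth false (missing D ++ take 2 (missing D)) i.+1
    = (ordS i \notin D).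
  have lt_i := ltn_ord i; rewrite nth_missing_cyclic //; last exact: ltnW.
  by rewrite -nth_missing.
have G (i : 'I_n) : nth false (missing D ++ take 2 (missing D)) i
    = (i \notin D).
  by rewrite nth_cat size_missing ltn_ord nth_missing.
apply: (iffP (no111P _)) => H i; first by rewrite -E -F -G.
case: (ltnP i n) => [lt_in|le_ni].
  by rewrite (E (Ordinal lt_in)) (F (Ordinal lt_in)) (G (Ordinal lt_in)).
(* From a start i >= n, the third letter lies beyond the n+2 letters and defaults to [false]. *)
rewrite [X in [&& _, _ & X]]nth_default ?andbF //.
by rewrite size_cat size_takel size_missing; lia.
Qed.

Lemma ordS_neq n (i : 'I_n) : 1 < n -> ordS i != i.
Proof.
move=> n_gt1; apply/eqP => /(congr1 val) /=.
case: (ltnP i.+1 n) => [/modn_small->|]; first by lia.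
move=> le_ni; have -> : i.+1 = n by have := ltn_ord i; lia.
by rewrite modnn; have := ltn_ord i; lia.
Qed.

(** A vertex is undominated exactly when it and both its neighbours are missing, which is a factor
    111 centred at it; hence the use of [ord_pred v] as its start. *)
Lemma lucas_missing n (D : {set 'I_n}) : 2 < n ->
  lucas (missing D) = @dominating (cycle_graph n) D.
Proof.
move=> n_gt2; apply/(lucas_missingP D n_gt2)/forall_inP => /= H.
  move=> v; rewrite inE => vD; apply/exists_inP.
  have := H (ord_pred v); rewrite ord_predK vD /=.
  have [iD _|_ /=] := boolP (ord_pred v \in D).
    exists (ord_pred v) => //; rewrite /cycle_edge ord_predK eqxx orbT andbT.
    by rewrite -{1}(ord_predK v) ordS_neq // ltnW.
  rewrite negbK => vD'; exists (ordS v) => //.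
  by rewrite /cycle_edge eqxx andbT eq_sym ordS_neq // ltnW.
move=> i; apply/negP => /and3P[iD iD1 iD2].
have /exists_inP[u uD] : [exists u in D, cycle_edge (ordS i) u].
  by apply: H; rewrite inE.
rewrite /cycle_edge => /andP[_ /orP[/eqP E|/eqP/ordS_inj E]].
  by rewrite E uD in iD2.
by rewrite -E uD in iD.
Qed.

Lemma dom_edge_adj n (X Y : domset (cycle_graph n)) :
  dom_edge X Y = adj (missing (val X)) (missing (val Y)).
Proof.
rewrite adj_map -size_filter /dom_edge cardE {1}/enum_mem -enumT.
congr (size _ == 1); apply: eq_filter => i; rewrite !inE.
by case: (i \in val X); case: (i \in val Y).
Qed.

Lemma mem_lucas_words n w : 2 < n ->
  reflect (exists X : domset (cycle_graph n), w = missing (val X))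
          (w \in lucas_words n).
Proof.
move=> n_gt2; rewrite mem_filter mem_words.
apply: (iffP andP) => [[Lw /eqP sw]|[[D DD] ->]]; last first.
  by rewrite lucas_missing // size_missing.
pose D := [set i : 'I_n | ~~ nth false w i].
have wE : w = missing D.
  apply: (eq_from_nth (x0 := false)); rewrite ?size_missing // sw => i lt_in.
  by rewrite (nth_missing D (Ordinal lt_in)) inE negbK.
have DD : @dominating (cycle_graph n) D by rewrite -lucas_missing // -wE.
by exists (exist _ D DD).
Qed.

Lemma hamilton_gray n : 2 < n ->
  has_hamilton_path (dominating_graph (cycle_graph n)) <->
  exists s, gray_list s (lucas_words n).
Proof.
move=> n_gt2.
pose f (X : dominating_graph (cycle_graph n)) := missing (val X).
have f_inj : injective f by move=> X Y /missing_inj /val_inj.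
have fE p x : path adj (f x) (map f p) = path (@sedge _) x p.
  by rewrite path_map; apply: eq_path => X Y; rewrite /= -dom_edge_adj.
have u_lucas : uniq (lucas_words n) by rewrite filter_uniq // uniq_words.
split=> [[x [p [Hp Up Ap]]]|[s [Hs Ps]]].
  exists (map f (x :: p)); split; first by rewrite -fE in Hp.
  apply: uniq_perm; rewrite ?map_inj_uniq // => w.
  apply/mapP/mem_lucas_words => // [[X _ ->]|[X ->]]; first by exists X.
  by exists X.
have fs : {subset s <= codom f}.
  move=> w; rewrite (perm_mem Ps) => /mem_lucas_words[//|X ->].
  exact: (codom_f f X).
have inS X : f X \in s.
  by rewrite (perm_mem Ps); apply/mem_lucas_words; last exists X.
have Us : uniq s by rewrite (perm_uniq Ps).
have [t st] : exists t, s = map f t.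
  by exists (preim_seq f s); rewrite map_preim.
have inT X : X \in t by rewrite -(mem_map f_inj) -st.
(* The full vertex set shows that [t] is nonempty, so that it has a first vertex. *)
have dT : @dominating (cycle_graph n) setT.
  by apply/forall_inP => v; rewrite setCT inE.
have := inT (exist _ setT dT : domset _).
case: t => // x p in st inT *; move=> _; exists x, p; split=> //.
  by rewrite -fE; rewrite st in Hs.
by rewrite -(map_inj_uniq f_inj) -st.
Qed.

Theorem theorem1p5 (n : nat) (hn : 3 <= n) :
  has_hamilton_path (dominating_graph (cycle_graph n)) <-> n <> 0 %[mod 4].
Proof.
rewrite hamilton_gray // mod0n.
have En : n = 4 * (n %/ 4) + n %% 4 by rewrite mulnC -divn_eq.
have: n %% 4 < 4 by rewrite ltn_pmod.
move: (n %/ 4) (n %% 4) En => k r -> {n} in hn *.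
(* The bound on n excludes quotient 0 except for remainder 3, where n = 3 is left as a separate
   case. *)
case: r => [|[|[|[|//]]]] in hn * => _; split=> //; case: k => // k in hn *.
- have -> : 4 * k.+1 + 0 = (4 * k).+4 by lia.
  by case=> s /lucas_no_gray_mod0.
- have -> : 4 * k.+1 + 1 = (4 * k).+1.+4 by lia.
  by move=> _; apply: lucas_gray_mod1.
- have -> : 4 * k.+1 + 2 = (4 * k).+2.+4 by lia.
  by move=> _; apply: lucas_gray_mod2.
- by move=> _; apply: lucas_gray3.
have -> : 4 * k.+1 + 3 = (4 * k).+3.+4 by lia.
by move=> _; apply: lucas_gray_mod3.
Qed.
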